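(* Let $n\ge2$ be an integer and suppose there exists no perfect difference set of order $n-1$. Then $$\inf_{|z_1|=\cdots=|z_n|=1}\ \max_{\nu=1,\dots,n^2-n}\left|\sum_{k=1}^n z_k^\nu\right| > \sqrt{n-1},$$ where the infimum is over all $n$-tuples $(z_1,\dots,z_n)$ of unimodular complex numbers.
   Context: A perfect difference set of order $q$ is a tuple of integers $(a_1,\ldots,a_{q+1})$ such that the differences $a_i-a_j$ with $i\ne j$ represent all nonzero residues modulo $q^2+q+1$. *)

(* Defs.v *)
From HB Require Export structures.
From mathcomp Require Export all_boot all_order all_algebra.
From mathcomp Require Export complex.
From mathcomp Require Export boolp classical_sets reals.
Set Implicit Arguments.
Unset Strict Implicit.
Unset Printing Implicit Defensive.
Import Order.TTheory GRing.Theory Num.Theory.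
Export ComplexField.Normc.
Local Open Scope ring_scope.

Definition perfect_difference_set (q : nat) (a : q.+1.-tuple int) : Prop :=
  forall r : int, (r != 0 %[mod (q ^ 2 + q + 1)%N])%Z ->
    exists i j : 'I_q.+1,
      i != j /\ (tnth a i - tnth a j = r %[mod (q ^ 2 + q + 1)%N])%Z.

Definition power_sum (R : realType) (n : nat) (z : n.-tuple R[i]) (nu : nat)
  : R[i] := \sum_(k < n) tnth z k ^+ nu.

(* The values are nonnegative, so the unit 0 of the iterated maximum does not
   affect it as soon as the range 1 <= nu <= m is nonempty. *)
Definition max_power_sum (R : realType) (n m : nat) (z : n.-tuple R[i]) : R :=
  \big[Num.max/0]_(1 <= nu < m.+1) normc (power_sum z nu).

(* Main.v *)
(** Let [S nu] be the [nu]-th power sum of unimodular [z_1, ..., z_n] and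
    [N = n^2 - n + 1].  Expanding squares on both sides gives
      [sum_{j,k} |sum_{a<N} (z_j / z_k)^a|^2 = sum_{a,b<N} |S (a - b)|^2].
    The diagonal on the left is [n N^2] and on the right [N n^2].  Hence, if
    [|S nu|^2 <= n - 1] for [0 < nu < N], then comparing both sides forces
    [|S nu|^2 = n - 1] for these [nu] and makes all off-diagonal terms on the
    left vanish, so that [z_j = z_1 w^(a_j)] with [w] a primitive [N]-th root of
    unity.  Fourier inversion on Z/N then shows that every nonzero residue is a
    difference of the [a_j], i.e. that they form a perfect difference set.
    The infimum is attained by compactness of the torus, so without a perfect
    difference set it exceeds [sqrt (n - 1)]. *)
Require Import Defs.
From mathcomp Require Import cyclic separable cyclotomic ring lra zify.
From mathcomp Require Import topology normedtype derive realfun.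
Set Implicit Arguments.
Unset Strict Implicit.
Unset Printing Implicit Defensive.
Import Order.TTheory GRing.Theory Num.Theory.
Import numFieldNormedType.Exports.
Local Open Scope classical_set_scope.
Local Open Scope ring_scope.

(** * Roots of unity *)

Lemma exists_prim_root (F : closedFieldType) (N : nat) :
  N%:R != 0 :> F -> exists w : F, N.-primitive_root w.
Proof.
move=> N_neq0; have N_gt0 : (0 < N)%N by case: (N) N_neq0 => //; rewrite eqxx.
have [s] := closed_field_poly_normal ('X^N - 1%:P : {poly F}).
rewrite (monicP (monicXnsubC 1 N_gt0)) scale1r => sE.
have s_size : size s = N.
  by apply: succn_inj; rewrite -(size_prod_XsubC s id) -sE size_XnsubC.
(* [X^N - 1] is separable because [N] is nonzero in [F], so its [N] roots are distinct; a finite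
   group of roots of unity is cyclic, and a generator has order [N]. *)
have s_uniq : uniq s by rewrite -separable_prod_XsubC -sE separable_Xn_sub_1.
have s_unity : all N.-unity_root s.
  by apply/allP => x xs; rewrite /root_of_unity -[1]/(1%:P) sE root_prod_XsubC.
have /hasP[w _ wP] : has N.-primitive_root s by rewrite has_prim_root ?s_size.
by exists w.
Qed.

Lemma sum_expr_unity_root (F : fieldType) (N : nat) (v : F) :
  v ^+ N = 1 -> v != 1 -> \sum_(a < N) v ^+ a = 0.
Proof.
move=> vN v1; have := subrX1 v N; rewrite vN subrr => /esym/eqP.
by rewrite mulf_eq0 subr_eq0 (negPf v1) => /eqP.
Qed.

(** * The double-sum identity and its equality case *)

Section FejerIdentity.
Variables (C : numClosedFieldType) (n : nat) (z : 'I_n -> C).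

(** Expanding [|x|^2] as [x * x^*] turns both sides into the same fourfold sum over [j, k, a, b];
    only the order of summation differs. *)
Lemma fejer_double_sum (N : nat) :
  \sum_j \sum_k `|\sum_(a < N) (z j * (z k)^*) ^+ a| ^+ 2 =
  \sum_(a < N) \sum_(b < N) `|\sum_j z j ^+ a * (z j)^* ^+ b| ^+ 2.
Proof.
transitivity (\sum_j \sum_k \sum_(a < N) \sum_(b < N)
   (z j ^+ a * (z j)^* ^+ b * ((z k)^* ^+ a * z k ^+ b))).
  apply: eq_bigr => j _; apply: eq_bigr => k _.
  rewrite normCK rmorph_sum mulr_suml; apply: eq_bigr => a _.
  rewrite mulr_sumr; apply: eq_bigr => b _.
  by rewrite rmorphXn rmorphM /= conjCK !exprMn; ring.
under eq_bigr do rewrite exchange_big.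
rewrite exchange_big; apply: eq_bigr => a _.
under eq_bigr do rewrite exchange_big.
rewrite exchange_big; apply: eq_bigr => b _.
rewrite normCK rmorph_sum mulr_suml; apply: eq_bigr => j _.
rewrite mulr_sumr; apply: eq_bigr => k _.
by rewrite rmorphM !rmorphXn /= conjCK.
Qed.

Hypothesis z_unit : forall k, `|z k| = 1.

Let mul_conj k : z k * (z k)^* = 1.
Proof. by rewrite -normCK z_unit expr1n. Qed.

(** With truncated subtraction, [a - b + (b - a)] is the distance [|a - b|]. Conjugating the sum
    swaps [a] and [b], and [(z j)^*] is the inverse of [z j]. *)
Lemma norm_sum_expr_conj (a b : nat) :
  `|\sum_j z j ^+ a * (z j)^* ^+ b| = `|\sum_j z j ^+ (a - b + (b - a))|.
Proof.
wlog le_ba : a b / (b <= a)%N => [hw|].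
  have [/hw//|/ltnW le_ab] := leqP b a.
  rewrite addnC -hw // -[LHS]norm_conjC rmorph_sum; congr `|_|.
  by apply: eq_bigr => j _; rewrite rmorphM !rmorphXn /= conjCK mulrC.
congr `|_|; apply: eq_bigr => j _.
move: (le_ba); rewrite -subn_eq0 => /eqP ->; rewrite addn0.
by rewrite -{1}(subnK le_ba) exprD -mulrA -exprMn mul_conj expr1n mulr1.
Qed.

Lemma power_sum_extremal (N := (n ^ 2 - n + 1)%N) :
  (forall nu, (0 < nu < N)%N ->
     `|\sum_k z k ^+ nu| ^+ 2 <= (n%:R - 1 : C)) ->
  (forall nu, (0 < nu < N)%N ->
     `|\sum_k z k ^+ nu| ^+ 2 = (n%:R - 1 : C)) /\
  (forall j k, j != k -> \sum_(a < N) (z j * (z k)^*) ^+ a = 0).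
Proof.
move=> hS.
pose G j k := `|\sum_(a < N) (z j * (z k)^*) ^+ a| ^+ 2.
(* For [a != b], [D a b] is the slack in the assumed bound at [nu = |a - b|]. *)
pose D (a b : 'I_N) :=
  (n%:R - 1 : C) - `|\sum_j z j ^+ a * (z j)^* ^+ b| ^+ 2.
have G_ge0 j k : 0 <= G j k by rewrite exprn_ge0.
have dist_gt0 (a b : 'I_N) : b != a -> (0 < a - b + (b - a) < N)%N.
  by rewrite -(inj_eq val_inj) /=; have := ltn_ord a; have := ltn_ord b; lia.
have D_ge0 (a b : 'I_N) : b != a -> 0 <= D a b.
  by move=> /dist_gt0 hab; rewrite subr_ge0 norm_sum_expr_conj hS.
have Gd j : G j j = N%:R ^+ 2.
  rewrite /G mul_conj; under eq_bigr do rewrite expr1n.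
  by rewrite sumr_const card_ord normr_nat.
have Dd a : D a a = n%:R - 1 - n%:R ^+ 2.
  rewrite /D norm_sum_expr_conj subnn.
  under eq_bigr do rewrite expr0.
  by rewrite sumr_const card_ord normr_nat.
have N_eq : N%:R = n%:R ^+ 2 - n%:R + 1 :> C.
  by rewrite /N natrD natrB ?natrX // -mulnn; case: (n) => // m; rewrite leq_pmulr.
(* By the identity, adding the slacks replaces each of the [N^2] squares by [n - 1]. *)
have GD : \sum_j \sum_k G j k + \sum_a \sum_b D a b = N%:R ^+ 2 * (n%:R - 1).
  rewrite /G fejer_double_sum -big_split /=.
  under eq_bigr => a _.
    rewrite -big_split /=; under eq_bigr do rewrite addrC subrK.
    rewrite sumr_const card_ord; over.
  by rewrite sumr_const card_ord -mulrnA -[LHS]mulr_natl natrM expr2.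
have splitG : \sum_j \sum_k G j k =
    n%:R * N%:R ^+ 2 + \sum_j \sum_(k | k != j) G j k.
  under eq_bigr => j _ do rewrite (bigD1 j) //= Gd.
  by rewrite big_split /= sumr_const card_ord mulr_natl.
have splitD : \sum_a \sum_b D a b =
    N%:R * (n%:R - 1 - n%:R ^+ 2) + \sum_a \sum_(b | b != a) D a b.
  under eq_bigr => a _ do rewrite (bigD1 a) //= Dd.
  by rewrite big_split /= sumr_const card_ord mulr_natl.
have sG_ge0 j : 0 <= \sum_(k | k != j) G j k by apply: sumr_ge0.
have sD_ge0 a : 0 <= \sum_(b | b != a) D a b by apply: sumr_ge0 => b; exact: D_ge0.
(* Since [n - 1 - n^2 = -N], the two diagonals give [n N^2 - N^2], already the whole total, so the
   nonnegative off-diagonal terms sum to zero. *)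
have : \sum_j \sum_(k | k != j) G j k + \sum_a \sum_(b | b != a) D a b == 0.
  apply/eqP; move: GD; rewrite splitG splitD N_eq => GD.
  apply: (addrI ((n%:R ^+ 2 - n%:R + 1) ^+ 2 * (n%:R - 1))).
  by rewrite -{2}GD; ring.
rewrite paddr_eq0 ?sumr_ge0 // !psumr_eq0 // => /andP[/allP G0 /allP D0].
split=> [nu /andP[nu_gt0 nu_lt]|j k].
  have N_gt0 : (0 < N)%N by rewrite /N addn1.
  (* The pair [(nu, 0)] realizes the distance [nu]. *)
  have := D0 (Ordinal nu_lt) (mem_index_enum _).
  rewrite /= psumr_eq0; last by move=> b; exact: D_ge0.
  move=> /allP /(_ (Ordinal N_gt0) (mem_index_enum _)) /implyP.
  rewrite -(inj_eq val_inj) /= ltn_eqF // => /(_ isT).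
  by rewrite /D norm_sum_expr_conj /= subn0 sub0n addn0 subr_eq0 => /eqP <-.
rewrite eq_sym => jk; have := G0 j (mem_index_enum _); rewrite /= psumr_eq0 //.
move=> /allP /(_ k (mem_index_enum _)) /implyP /(_ jk).
by rewrite expf_eq0 /= normr_eq0 => /eqP.
Qed.

End FejerIdentity.

(** * From extremal power sums to a perfect difference set *)

Lemma extremal_perfect_difference_set (C : numClosedFieldType) (q : nat)
    (z : 'I_q.+1 -> C) :
  (forall k, `|z k| = 1) ->
  (forall nu, (0 < nu < q ^ 2 + q + 1)%N ->
     `|\sum_k z k ^+ nu| ^+ 2 <= q%:R) ->
  exists a : q.+1.-tuple int, perfect_difference_set a.
Proof.
move=> z1 hS.
have := @power_sum_extremal _ _ z z1.
have -> : (q.+1 ^ 2 - q.+1 + 1 = q ^ 2 + q + 1)%N by rewrite -!mulnn; lia.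
rewrite -natr1 addrK => /(_ hS) [{}hS hG].
set N := (q ^ 2 + q + 1)%N in hS hG *.
have N_gt0 : (0 < N)%N by rewrite /N addn1.
have N_neq0 : N%:R != 0 :> C by rewrite pnatr_eq0 -lt0n.
have [w wP] := @exists_prim_root C N N_neq0.
have w1 : `|w| = 1.
  apply/eqP; rewrite -(@pexpr_eq1 _ _ N) //.
  by rewrite -normrX prim_expr_order // normr1.
(* For [k != 0] the geometric sum of the ratio vanishes, and [v^N - 1] is a multiple of that sum, so
   the ratio is an [N]-th root of unity. *)
have wE k : exists i : 'I_N, z k * (z ord0)^* = w ^+ i.
  have hN : (z k * (z ord0)^*) ^+ N = 1.
    have [->|k0] := eqVneq k ord0; first by rewrite -normCK z1 !expr1n.
    by apply/eqP; rewrite -subr_eq0 subrX1 hG // mulr0.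
  by have [i ->] := prim_rootP wP hN; exists i.
have [e eP] := boolp.choice wE.
have zE j k : z j * (z k)^* = w ^+ e j * w^* ^+ e k.
  rewrite -rmorphXn -!eP rmorphM /= conjCK.
  have z0 : z ord0 * (z ord0)^* = 1 by rewrite -normCK z1 expr1n.
  by rewrite -[LHS]mulr1 -z0; ring.
exists [tuple (e k : nat)%:Z | k < q.+1] => r; rewrite mod0z => r_neq0.
set s := `|(r %% N)%Z|%N.
have sE : (r %% N)%Z = s%:Z by rewrite /s gez0_abs // modz_ge0 // -lt0n.
have s_gt0 : (0 < s)%N by rewrite lt0n -eqz_nat -sE.
have s_lt : (s < N)%N by rewrite -ltz_nat -sE ltz_mod // -lt0n.
apply: contrapT => noij.
(* Equality would make [r] congruent to [e j - e k]: excluded by assumption if [j != k], and by [r]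
   being nonzero if [j = k]. *)
have neq j k : w ^+ e j != w ^+ (e k + s).
  rewrite (eq_prim_root_expr wP); apply/negP => /eqP jk.
  have jkr : ((e j)%:Z - (e k)%:Z = r %[mod N])%Z.
    apply/eqP; rewrite -[(r %% N)%Z]modz_mod sE eqz_mod_dvd -addrA -opprD.
    by rewrite -eqz_mod_dvd -PoszD !modz_nat jk.
  have [jk_eq|jk_neq] := eqVneq j k.
    by move: jkr r_neq0; rewrite jk_eq subrr mod0z => <-; rewrite eqxx.
  by apply: noij; exists j, k; rewrite !tnth_mktuple.
have w_conj : w * w^* = 1 by rewrite -normCK w1 expr1n.
have wcN : w^* ^+ N = 1 by rewrite -rmorphXn prim_expr_order // rmorph1.
have sqS nu : `|\sum_k z k ^+ nu| ^+ 2 =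
    \sum_j \sum_k (w ^+ e j * w^* ^+ e k) ^+ nu.
  rewrite normCK rmorph_sum mulr_suml; apply: eq_bigr => j _.
  rewrite mulr_sumr; apply: eq_bigr => k _.
  by rewrite rmorphXn -exprMn zE.
(* This Fourier coefficient of [|S nu|^2] is [N] times the number of pairs with [e j - e k]
   congruent to [s]; by [neq] there are none. *)
have sum0 : \sum_(nu < N) `|\sum_k z k ^+ nu| ^+ 2 * (w^* ^+ s) ^+ nu = 0.
  under eq_bigr => nu _ do rewrite sqS mulr_suml.
  rewrite exchange_big big1 // => j _.
  under eq_bigr => nu _ do rewrite mulr_suml.
  rewrite exchange_big big1 // => k _.
  under eq_bigr => nu _ do rewrite -exprMn -mulrA -exprD.
  apply: sum_expr_unity_root.
    rewrite exprMn -!exprM ![(_ * N)%N]mulnC !exprM wcN.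
    by rewrite (prim_expr_order wP) !expr1n mulr1.
  apply: contra (neq j k) => /eqP h1; apply/eqP.
  rewrite -[LHS]mulr1 -(expr1n _ (e k + s)) -[in LHS]w_conj mulrC exprMn.
  by rewrite -mulrA [w^* ^+ _ * _]mulrC h1 mulr1.
have sumc : \sum_(nu < N) (w^* ^+ s) ^+ nu = 0.
  apply: sum_expr_unity_root; first by rewrite -exprM mulnC exprM wcN expr1n.
  by rewrite -rmorphXn fmorph_eq1 -(prim_order_dvd wP) gtnNdvd.
pose o := Ordinal N_gt0.
(* Isolate [nu = 0], where the square is [(q + 1)^2]; elsewhere it is [q] and the characters sum to
   [-1]. Hence [(q + 1)^2 - q = N] would vanish. *)
move: sumc; rewrite (bigD1 o) //= expr0 => sumc.
move: sum0; rewrite (bigD1 o) //= expr0 mulr1.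
under [\sum_(k < q.+1) _]eq_bigr do rewrite expr0.
rewrite sumr_const card_ord normr_nat.
under eq_bigr => nu nu_o.
  rewrite hS; last by rewrite ltn_ord andbT lt0n.
  over.
rewrite -mulr_sumr => sum0.
have : N%:R = 0 :> C.
  have {}sumc : \sum_(nu < N | nu != o) (w^* ^+ s) ^+ nu = -1.
    by apply/eqP; rewrite -addr_eq0 addrC sumc.
  by rewrite -sum0 sumc !natrD natrX -natr1; ring.
by move/eqP; rewrite (negPf N_neq0).
Qed.

(** * Continuity of power sums and compactness of the torus *)

Section ComplexContinuity.
Variables (R : realType) (T : topologicalType).
Implicit Types f g : T -> R[i].

(** Continuity is taken componentwise, so that only the topology of [R] is involved. *)
Definition continuousC f :=
  continuous (@complex.Re R \o f) /\ continuous (@complex.Im R \o f).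

Lemma continuousC_cst c : continuousC (fun=> c).
Proof. by split => x; exact: cvg_cst. Qed.

Lemma continuousC_add f g :
  continuousC f -> continuousC g -> continuousC (fun x => f x + g x).
Proof.
move=> [f1 f2] [g1 g2]; split => x.
  have -> : @complex.Re R \o (fun x => f x + g x) =
    (fun x => (@complex.Re R \o f) x + (@complex.Re R \o g) x).
    by apply/funext => y /=; case: (f y) (g y) => [? ?] [].
  by apply: cvgD; [exact: f1|exact: g1].
have -> : @complex.Im R \o (fun x => f x + g x) =
    (fun x => (@complex.Im R \o f) x + (@complex.Im R \o g) x).
  by apply/funext => y /=; case: (f y) (g y) => [? ?] [].
by apply: cvgD; [exact: f2|exact: g2].
Qed.

Lemma continuousC_mul f g :
  continuousC f -> continuousC g -> continuousC (fun x => f x * g x).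
Proof.
move=> [f1 f2] [g1 g2]; split => x.
  have -> : @complex.Re R \o (fun x => f x * g x) =
      (fun x => (@complex.Re R \o f) x * (@complex.Re R \o g) x -
                (@complex.Im R \o f) x * (@complex.Im R \o g) x).
    by apply/funext => y /=; case: (f y) (g y) => [? ?] [].
  by apply: cvgB; apply: cvgM; [exact: f1|exact: g1|exact: f2|exact: g2].
have -> : @complex.Im R \o (fun x => f x * g x) =
    (fun x => (@complex.Re R \o f) x * (@complex.Im R \o g) x +
              (@complex.Im R \o f) x * (@complex.Re R \o g) x).
  by apply/funext => y /=; case: (f y) (g y) => [? ?] [].
by apply: cvgD; apply: cvgM; [exact: f1|exact: g2|exact: f2|exact: g1].
Qed.

Lemma continuousC_exp f m : continuousC f -> continuousC (fun x => f x ^+ m).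
Proof.
move=> cf; elim: m => [|m IHm]; first exact: continuousC_cst.
have -> : (fun x => f x ^+ m.+1) = (fun x => f x * f x ^+ m).
  by apply/funext => x; rewrite exprS.
exact: continuousC_mul.
Qed.

Lemma continuousC_sum (I : Type) (s : seq I) (F : I -> T -> R[i]) :
  (forall i, continuousC (F i)) -> continuousC (fun x => \sum_(i <- s) F i x).
Proof.
move=> cF; elim: s => [|i s IHs].
  have -> : (fun x => \sum_(i <- [::]) F i x) = (fun=> 0).
    by apply/funext => x; rewrite big_nil.
  exact: continuousC_cst.
have -> : (fun x => \sum_(j <- i :: s) F j x) =
          (fun x => F i x + \sum_(j <- s) F j x).
  by apply/funext => x; rewrite big_cons.
exact: continuousC_add.
Qed.

Lemma continuous_normc f : continuousC f -> continuous (fun x => normc (f x)).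
Proof.
move=> [f1 f2].
have -> : (fun x => normc (f x)) = Num.sqrt \o
    (fun x => (@complex.Re R \o f) x ^+ 2 + (@complex.Im R \o f) x ^+ 2).
  by apply/funext => x; rewrite /normc /=; case: (f x).
move=> x; apply: continuous_comp; last exact: sqrt_continuous.
by apply: cvgD; apply: cvgM; (exact: f1 || exact: f2).
Qed.

Lemma continuous_bigmax (I : Type) (s : seq I) (F : I -> T -> R) :
  (forall i, continuous (F i)) ->
  continuous (fun x => \big[Num.max/0]_(i <- s) F i x).
Proof.
move=> cF; elim: s => [|i s IHs] x.
  have -> : (fun x => \big[Num.max/0]_(i <- [::]) F i x) = (fun=> 0).
    by apply/funext => y; rewrite big_nil.
  exact: cvg_cst.
have -> : (fun x => \big[Num.max/0]_(j <- i :: s) F j x) =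
          (fun x => Num.max (F i x) (\big[Num.max/0]_(j <- s) F j x)).
  by apply/funext => y; rewrite big_cons.
by apply: continuous_max; [exact: cF|exact: IHs].
Qed.

End ComplexContinuity.

(** The extreme value theorem on the torus, viewed inside real row vectors of length [n + n]: real
    parts in the left block, imaginary parts in the right one. *)
Lemma max_power_sum_attains_min (R : realType) (n m : nat) :
  exists2 z : n.-tuple R[i], (forall k, normc (tnth z k) = 1) &
    forall t : n.-tuple R[i], (forall k, normc (tnth t k) = 1) ->
      max_power_sum m z <= max_power_sum m t.
Proof.
pose Z (v : 'rV[R]_(n + n)) : n.-tuple R[i] :=
  [tuple (v ord0 (lshift n k) +i* v ord0 (rshift n k))%C | k < n].
pose V (z : n.-tuple R[i]) : 'rV[R]_(n + n) :=
  row_mx (\row_k @complex.Re R (tnth z k)) (\row_k @complex.Im R (tnth z k)).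
have VK z : Z (V z) = z.
  apply: eq_from_tnth => k; rewrite tnth_mktuple row_mxEl row_mxEr !mxE.
  by case: (tnth z k).
have cZ k : continuousC (fun v => tnth (Z v) k).
  have -> : (fun v => tnth (Z v) k) =
      (fun v => (v ord0 (lshift n k) +i* v ord0 (rshift n k))%C).
    by apply/funext => v; rewrite tnth_mktuple.
  by split => v; exact: coord_continuous.
(* A closed subset of a compact cube; coordinates of unimodular numbers lie in [[-1, 1]]. *)
pose A : set 'rV[R]_(n + n) :=
  [set v : 'rV[R]_(n + n) | forall i, `[-1, 1]%classic (v ord0 i)] `&`
  [set v : 'rV[R]_(n + n) | forall k, normc (tnth (Z v) k) = 1].
have AV z : (forall k, normc (tnth z k) = 1) -> A (V z).
  move=> z1; split => [i|k]; last by rewrite VK.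
  have sq (a b : R) : Num.sqrt (a ^+ 2 + b ^+ 2) = 1 ->
      `[-1, 1]%classic a /\ `[-1, 1]%classic b.
    move=> /(congr1 (fun x => x ^+ 2)).
    rewrite sqr_sqrtr ?addr_ge0 ?sqr_ge0 // expr1n => ab1.
    by rewrite /= !in_itv /=; split; apply/andP; split; nra.
  rewrite /V; case: (split_ordP i) => k ->; rewrite ?row_mxEl ?row_mxEr mxE;
    have := z1 k; case: (tnth z k) => a b /sq[]//.
have Acompact : compact A.
  apply: compact_closedI.
    by apply: (@rV_compact R _ (fun=> `[-1, 1]%classic)) => i; exact: segment_compact.
  have -> : [set v : 'rV[R]_(n + n) | forall k, normc (tnth (Z v) k) = 1] =
     \bigcap_(k in setT) ((fun v => normc (tnth (Z v) k)) @^-1` [set 1]).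
    by apply/seteqP; split => v /= h k; [move=> _|]; apply: h.
  apply: closed_bigI => k _; apply: closed_comp => [v _|]; last exact: closed_eq.
  exact: continuous_normc.
pose z1 : n.-tuple R[i] := [tuple 1 | k < n].
have A0 : A !=set0.
  by exists (V z1); apply: AV => k; rewrite tnth_mktuple normc1.
have cf : continuous (fun v => max_power_sum m (Z v)).
  apply: continuous_bigmax => nu; apply: continuous_normc.
  by apply: continuousC_sum => k; apply: continuousC_exp.
have [c] := @compact_EVT_min _ _ (fun v => max_power_sum m (Z v)) _ A0 Acompact
  (continuous_subspaceT cf).
rewrite inE => -[_ cA] cmin; exists (Z c) => // t t1.
by rewrite -(VK t); apply: cmin; rewrite inE; exact: AV.
Qed.

(** * Strict bound for the infimum *)

Theorem corollary1 (R : realType) (n : nat) (hn : (2 <= n)%N)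
  (hpds : ~ exists a : n.-1.+1.-tuple int, perfect_difference_set a) :
  Num.sqrt (n%:R - 1) <
    inf [set max_power_sum (n ^ 2 - n)%N z
        | z in [set z : n.-tuple R[i] | forall k : 'I_n, normc (tnth z k) = 1]]
    :> R.
Proof.
case: n hn hpds => // q _ /= hpds.
set m := (q.+1 ^ 2 - q.+1)%N.
have [z z1 zmin] := @max_power_sum_attains_min R q.+1 m.
(* The value at the minimizer is a lower bound of the set, so strictness there survives passing to
   the infimum. *)
apply: (@lt_le_trans _ _ (max_power_sum m z)); last first.
  apply: lb_le_inf; first by exists (max_power_sum m z), z.
  by move=> _ [t t1 <-]; exact: zmin.
rewrite -natr1 addrK ltNge; apply/negP => max_le; apply: hpds.
apply: (@extremal_perfect_difference_set _ _ (tnth z)) => [k|nu nuN].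
  by rewrite -[LHS]/((normc _)%:C)%C z1.
(* The norm of [R[i]] is [normc] embedded as a real complex number, so the bound descends to [R]. *)
rewrite -[X in X ^+ 2]/((normc _)%:C)%C.
have S_le : normc (power_sum z nu) <= Num.sqrt q%:R.
  apply: le_trans max_le; apply: (le_bigmax_seq (r := index_iota 1 m.+1)) => //.
  by rewrite mem_index_iota /m -mulnn; lia.
rewrite -rmorphXn -(rmorph_nat (real_complex R)) lecR.
rewrite -[leRHS]sqr_sqrtr ?ler0n // lerXn2r // nnegrE ?sqrtr_ge0 //.
by rewrite /normc; case: (\sum_k _) => x y; exact: sqrtr_ge0.
Qed.
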